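(* Let $S$ be a topological space. Let $\varphi: S^2+S^2\to S^3$ be the continuous map which sends a point $(x,y)$ of the first copy of $S^2$ to $(x,y,y)$ and a point $(x,y)$ of the second copy of $S^2$ to $(y,y,x)$, and let $\varphi = k\circ r'$, with $r': S^2+S^2\to R'$ and $k: R'\to S^3$, be the (epimorphism, regular monomorphism)-factorization of $\varphi$ in the category $\mathbf{Top}$ of topological spaces and continuous maps. Then the following are equivalent: (a) $S$ is a co-Mal'tsev object in $\mathbf{Top}$; (b) there is a (unique) morphism $f: R'\to S$ in $\mathbf{Top}$ such that $f\circ r'$ is the map $S^2+S^2\to S$ whose restriction to each of the two copies of $S^2$ is the first projection $\pi_1: S^2\to S$; (c) for every open set $A$ in $S$, there is an open set $A'$ in $S^3$ such that for all $(x,y)\in S^2$, $$x\in A \Leftrightarrow (x,y,y)\in A' \Leftrightarrow (y,y,x)\in A';$$ (d) $S$ is an $R_1$-space.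
   Context: An internal relation from $X$ to $Y$ in a category $\mathbb{C}$ is a triple $(R,r_1,r_2)$ where $r_1:R\to X$ and $r_2:R\to Y$ are jointly monomorphic morphisms of $\mathbb{C}$. For an object $S$ and morphisms $f:S\to X$, $g:S\to Y$, write $fRg$ if there is $h:S\to R$ with $r_1h=f$ and $r_2h=g$. An object $S$ of $\mathbb{C}$ is a Mal'tsev object if for all objects $X,Y$, every internal relation $(R,r_1,r_2)$ from $X$ to $Y$ and all morphisms $x_1,x_2:S\to X$ and $y_1,y_2:S\to Y$: if $x_1Ry_2$, $x_2Ry_2$ and $x_2Ry_1$, then $x_1Ry_1$. An object of $\mathbb{C}$ is a co-Mal'tsev object if it is a Mal'tsev object of the dual category $\mathbb{C}^{\mathrm{op}}$. A topological space $X$ is an $R_1$-space if for all $x,y\in X$: if there exists an open set $A$ with $x\in A$ and $y\notin A$, then there exist disjoint open sets $B$ and $C$ with $x\in B$ and $y\in C$. $S^2+S^2$ denotes the coproduct (disjoint union) in $\mathbf{Top}$. Regular monomorphisms in $\mathbf{Top}$ are the embeddings of spaces. *)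

(* Defs.v *)
From mathcomp Require Import all_boot all_classical.
From mathcomp Require Import topology.

Set Implicit Arguments.
Unset Strict Implicit.
Unset Printing Implicit Defensive.

Local Open Scope classical_set_scope.

Record category := Category {
  obj : Type;
  hom : obj -> obj -> Type;
  idm : forall X, hom X X;
  comp : forall X Y Z, hom Y Z -> hom X Y -> hom X Z;
  comp1m : forall X Y (f : hom X Y), comp (idm Y) f = f;
  compm1 : forall X Y (f : hom X Y), comp f (idm X) = f;
  compA : forall X Y Z W (h : hom Z W) (g : hom Y Z) (f : hom X Y),
    comp h (comp g f) = comp (comp h g) f
}.

Arguments hom : clear implicits.
Arguments comp {c X Y Z} g f.

Notation "g \oc f" := (comp g f) (at level 50, left associativity).

Definition op (C : category) : category :=
  @Category (obj C) (fun X Y => hom C Y X) (@idm C)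
    (fun X Y Z g f => f \oc g)
    (fun X Y f => compm1 f) (fun X Y f => comp1m f)
    (fun X Y Z W h g f => esym (compA f g h)).

Definition jointly_monic (C : category) (R X Y : obj C)
    (r1 : hom C R X) (r2 : hom C R Y) : Prop :=
  forall (T : obj C) (u v : hom C T R),
    r1 \oc u = r1 \oc v -> r2 \oc u = r2 \oc v -> u = v.

Record internal_relation (C : category) (X Y : obj C) := InternalRelation {
  rel_obj : obj C;
  rel1 : hom C rel_obj X;
  rel2 : hom C rel_obj Y;
  rel_jointly_monic : jointly_monic rel1 rel2
}.

Definition related (C : category) (X Y : obj C) (R : internal_relation X Y)
    (S : obj C) (f : hom C S X) (g : hom C S Y) : Prop :=
  exists h : hom C S (rel_obj R), rel1 R \oc h = f /\ rel2 R \oc h = g.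

Definition maltsev_object (C : category) (S : obj C) : Prop :=
  forall (X Y : obj C) (R : internal_relation X Y)
    (x1 x2 : hom C S X) (y1 y2 : hom C S Y),
    related R x1 y2 -> related R x2 y2 -> related R x2 y1 -> related R x1 y1.

Arguments maltsev_object : clear implicits.

Definition co_maltsev_object (C : category) (S : obj C) : Prop :=
  maltsev_object (op C) S.

Arguments co_maltsev_object : clear implicits.

Definition epimorphism (C : category) (X Y : obj C) (e : hom C X Y) : Prop :=
  forall (Z : obj C) (u v : hom C Y Z), u \oc e = v \oc e -> u = v.

Definition is_equalizer (C : category) (E X Y : obj C)
    (m : hom C E X) (u v : hom C X Y) : Prop :=
  u \oc m = v \oc m /\
  forall (T : obj C) (t : hom C T X), u \oc t = v \oc t ->
    exists! s : hom C T E, m \oc s = t.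

Definition regular_monomorphism (C : category) (E X : obj C)
    (m : hom C E X) : Prop :=
  exists (Y : obj C) (u v : hom C X Y), is_equalizer m u v.

Lemma Top_comp1m (X Y : topologicalType) (f : continuousType X Y) :
  (idfun \o f : continuousType X Y) = f.
Proof. exact/continuousEP. Qed.

Lemma Top_compm1 (X Y : topologicalType) (f : continuousType X Y) :
  (f \o idfun : continuousType X Y) = f.
Proof. exact/continuousEP. Qed.

Lemma Top_compA (X Y Z W : topologicalType) (h : continuousType Z W)
    (g : continuousType Y Z) (f : continuousType X Y) :
  (h \o (g \o f : continuousType X Z) : continuousType X W) =
  ((h \o g : continuousType Y W) \o f : continuousType X W).
Proof. exact/continuousEP. Qed.

Definition Top : category :=
  @Category topologicalType (fun X Y => continuousType X Y)
    (fun X => idfun) (fun X Y Z g f => g \o f)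
    Top_comp1m Top_compm1 Top_compA.

Definition R1_space (X : topologicalType) : Prop :=
  forall x y : X,
    (exists A : set X, [/\ open A, A x & ~ A y]) ->
    exists B C : set X, [/\ open B, open C, B x, C y & B `&` C = set0].

Definition square (S : topologicalType) : topologicalType := (S * S)%type.

Definition cube (S : topologicalType) : topologicalType := (S * S * S)%type.

(* The coproduct S^2 + S^2 as the bool-indexed disjoint union of spaces:
   [true] labels the first copy of S^2 and [false] the second one. *)
Definition two_squares (S : topologicalType) : topologicalType :=
  {b : bool & square S}.

Definition phi_fun (S : topologicalType) (p : two_squares S) : cube S :=
  let (x, y) := projT2 p in if projT1 p then (x, y, y) else (y, y, x).

Definition copi1_fun (S : topologicalType) (p : two_squares S) : S :=
  (projT2 p).1.

Lemma phi_continuous (S : topologicalType) : continuous (@phi_fun S).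
Proof.
move=> -[b q].
suff h : (fun q : square S => phi_fun (existT _ b q)) @ nbhs q -->
    phi_fun (existT _ b q) by exact: h.
have -> : (fun q : square S => phi_fun (existT _ b q)) =
    (fun q => if b then (q.1, q.2, q.2) else (q.2, q.2, q.1)).
  by apply/funext => -[].
have -> : phi_fun (existT _ b q) =
    if b then (q.1, q.2, q.2) else (q.2, q.2, q.1) by case: q.
have c1 : (fun p : square S => p.1) @ nbhs q --> q.1.
  exact: (@cvg_fst _ _ (nbhs q.1) (nbhs q.2)).
have c2 : (fun p : square S => p.2) @ nbhs q --> q.2.
  exact: (@cvg_snd _ _ (nbhs q.1) (nbhs q.2)).
case: b.
  exact: (cvg_pair (cvg_pair c1 c2) c2).
exact: (cvg_pair (cvg_pair c2 c2) c1).
Qed.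

Lemma copi1_continuous (S : topologicalType) : continuous (@copi1_fun S).
Proof. by move=> -[b q]; exact: (@cvg_fst _ _ (nbhs q.1) (nbhs q.2)). Qed.

Definition phi (S : topologicalType) : hom Top (two_squares S) (cube S) :=
  mkcts (@phi_continuous S).

Definition copi1 (S : topologicalType) : hom Top (two_squares S) S :=
  mkcts (@copi1_continuous S).

(* Main.v *)
Require Import Defs.
From mathcomp Require Import all_boot all_classical.
From mathcomp Require Import topology.

(** For jointly surjective maps [r1 : X -> R], [r2 : Y -> R] and [a, b, c : R -> S]
    exhibiting [x1 R y2], [x2 R y2] and [x2 R y1], the map [(a, b, c) : R -> S^3]
    takes values in the image of [phi], i.e. among the triples [(x, y, y)] and
    [(y, y, x)]. Sending such a triple to [x] is the universal solution of the
    co-Mal'tsev problem: (b) says that it is continuous on the image of [phi] with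
    the subspace topology, and (c) spells this out on open sets. For (d) => (c)
    one can take for [A'] the largest open set of triples [(u, v, w)] such that
    [v = w] implies [u] in [A] and [u = v] implies [w] in [A]. *)

Set Implicit Arguments.
Unset Strict Implicit.
Unset Printing Implicit Defensive.

Local Open Scope classical_set_scope.

(** Condition (c). The mirror is the swap of (u, v, w) with (w, v, u), which exchanges the triples
    (x, y, y) and (y, y, x). *)
Definition mirrored_open_extension (S : topologicalType) : Prop :=
  forall A : set S, open A ->
    exists A' : set (S * S * S)%type, open A' /\
      forall x y : S, (A x <-> A' (x, y, y)) /\ (A' (x, y, y) <-> A' (y, y, x)).

Lemma nbhs_prod3P (X Y Z : topologicalType) (x : X) (y : Y) (z : Z)
    (A : set (X * Y * Z)) :
  nbhs (x, y, z) A <->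
  exists U V W, [/\ open_nbhs x U, open_nbhs y V, open_nbhs z W &
    forall u v w, U u -> V v -> W w -> A (u, v, w)].
Proof.
split=> [[[P W] /= [[[U V] /= [nU nV] UVP] nW] PWA]|].
  move: nU nV nW; rewrite !nbhsE => -[U' oU' sU] [V' oV' sV] [W' oW' sW].
  exists U', V', W'; split=> // u v w /sU Uu /sV Vv /sW Ww.
  by apply: (PWA (_, _)); split=> //; apply: (UVP (_, _)).
case=> U [V] [W] [/open_nbhs_nbhs nU /open_nbhs_nbhs nV /open_nbhs_nbhs nW sA].
exists (U `*` V, W); first by split=> //=; exists (U, V).
by move=> [[u v] w] [[/= Uu Vv] Ww]; apply: sA.
Qed.

(** The indicator of a point [p] outside both ranges and the constant [false] agree on the ranges
    but differ at [p]; an indiscrete codomain makes both continuous. *)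
Lemma jointly_epic_surjective (X Y R : topologicalType)
    (r1 : hom Top X R) (r2 : hom Top Y R) :
  @jointly_monic (op Top) R X Y r1 r2 -> range r1 `|` range r2 = setT.
Proof.
move=> epi; rewrite -subTset => p _; apply: contrapT => np.
(* The topology induced by a constant map is indiscrete. *)
pose Z : topologicalType := initial_topology (fun _ : bool => true).
have ctsZ (f : R -> Z) : continuous f.
  apply/continuousP => A oA; have [B _ <-] : wopen (fun _ : bool => true) A := oA.
  have [Btt|nBtt] := pselect (B true).
    by rewrite (_ : _ @^-1` _ = setT) ?predeqE//; exact: openT.
  by rewrite (_ : _ @^-1` _ = set0) ?predeqE//; exact: open0.
pose u : hom Top R Z := mkcts (@ctsZ (fun q => `[< q = p >])).
pose v : hom Top R Z := mkcts (@ctsZ (fun=> false)).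
have ne q : q <> p -> u q = v q by move=> qp; apply/asboolPn.
have euv : u = v.
  apply: (epi Z u v); apply/continuousEP => q; apply: ne => e; apply: np.
    by left; exists q.
  by right; exists q.
have : u p = v p by rewrite euv.
by move/asboolPn; apply.
Qed.

(** An equalizer carries the subspace topology: if [W] is the set [E] with the topology induced by
    [m], then [m] still equalizes [u] and [v] on [W], so it lifts to a continuous [s : W -> E],
    which is the identity on points. *)
Lemma regular_mono_open (E X : topologicalType) (m : hom Top E X) (O : set E) :
  regular_monomorphism m -> open O -> exists2 A : set X, open A & m @^-1` A = O.
Proof.
case=> Y [u] [v] [umvm univ] oO.
pose W : topologicalType := initial_topology m.
have ctsm : continuous (m : W -> X) by exact: initial_continuous.
have ctsid : continuous (id : E -> W).
  apply/continuousP => V oV; have [A oA <-] : wopen m V := oV.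
  suff oE : @open E (m @^-1` A) by exact: oE.
  by apply: open_comp => // x _; exact: cts_fun.
pose t : hom Top W X := mkcts ctsm; pose i : hom Top E W := mkcts ctsid.
have umE x : u (m x) = v (m x) by have /continuousEP := umvm; apply.
have [s [mst _]] : exists! s : hom Top W E, m \oc s = t.
  by apply: univ; apply/continuousEP.
have mstE x : m (s x) = m x by have /continuousEP := mst; apply.
(* Uniqueness in the universal property does the work of injectivity of [m]: both [s \oc i] and the
   identity lift [m] through itself. *)
have sE : s \oc i = @idm Top E.
  have [z [_ uniq]] := univ E m umvm.
  rewrite -(uniq (s \oc i)); last by apply/continuousEP.
  by apply: uniq; apply/continuousEP.
have sid x : s x = x by have /continuousEP := sE; apply.
have [A oA AO] : wopen m (s @^-1` O).
  by change (open (s @^-1` O)); apply: open_comp => // x _; exact: cts_fun.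
by exists A => //; rewrite [LHS]AO; apply/predeqP => x /=; rewrite sid.
Qed.

Lemma mirrored_open_extension_co_maltsev (S : topologicalType) :
  mirrored_open_extension S -> co_maltsev_object Top S.
Proof.
move=> ext X Y [R r1 r2 epi] x1 x2 y1 y2 /=.
move=> [a [/continuousEP a1 /continuousEP a2]].
move=> [b [/continuousEP b1 /continuousEP b2]].
move=> [c [/continuousEP c1 /continuousEP c2]].
have {}a1 x : a (r1 x) = x1 x by exact: a1.
have {}a2 y : a (r2 y) = y2 y by exact: a2.
have {}b1 x : b (r1 x) = x2 x by exact: b1.
have {}b2 y : b (r2 y) = y2 y by exact: b2.
have {}c1 x : c (r1 x) = x2 x by exact: c1.
have {}c2 y : c (r2 y) = y1 y by exact: c2.
(* On [range r1] one has [b = c] and the value must be [a]; on [range r2] one has [a = b] and it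
   must be [c]. Where the ranges meet, [a = b = c], so the two demands agree. *)
pose h p := if b p == c p then a p else c p.
have h1 x : h (r1 x) = x1 x by rewrite /h b1 c1 eqxx.
have h2 y : h (r2 y) = y1 y.
  by rewrite /h; case: eqP => // bc; rewrite a2 -c2 -bc b2.
have ctsabc : continuous (fun p => (a p, b p, c p)).
  move=> p.
  exact: cvg_pair (cvg_pair (@cts_fun _ _ a p) (@cts_fun _ _ b p)) (@cts_fun _ _ c p).
have ctsh : continuous h.
  apply/continuousP => A oA; have [A' [oA' AA']] := ext A oA.
  rewrite (_ : h @^-1` A = (fun p => (a p, b p, c p)) @^-1` A').
    by apply: open_comp => // p _; exact: ctsabc.
  apply/predeqP => p /=.
  have : (range r1 `|` range r2) p.
    by rewrite (jointly_epic_surjective epi).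
  case=> -[q _ <-]; rewrite ?h1 ?h2.
    by rewrite a1 b1 c1; exact: (AA' _ _).1.
  by rewrite a2 b2 c2; have [-> ->] := AA' (y1 q) (y2 q).
pose g : hom Top R S := mkcts ctsh.
by exists g; split; apply/continuousEP.
Qed.

Lemma R1_mirrored_open_extension (S : topologicalType) :
  R1_space S -> mirrored_open_extension S.
Proof.
move=> R1 A oA.
pose P := [set p : S * S * S |
  (p.1.2 = p.2 -> A p.1.1) /\ (p.1.1 = p.1.2 -> A p.2)].
exists P°; split; first exact: open_interior.
have AP x y : A x -> P° (x, y, y) /\ P° (y, y, x).
  (* If [y] is in [A], the box with all sides [A] lies in [P]. Otherwise [A] separates [x] from [y],
     and the disjoint [B] and [C] give a box on which one of the two implications defining [P] is
     vacuous. *)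
  move=> Ax; have [Ay|nAy] := pselect (A y).
    by split; apply/nbhs_prod3P; exists A, A, A; split=> // u v w Au Av Aw; split.
  have [|B [C [oB oC Bx Cy BC0]]] := R1 x y; first by exists A; split.
  have BC z : B z -> C z -> False.
    by move=> Bz Cz; rewrite -[False]/(set0 z) -BC0.
  have oAB : open_nbhs x (A `&` B) by split; [exact: openI|].
  split; apply/nbhs_prod3P.
    exists (A `&` B), C, C; split=> // u v w [Au Bu] Cv Cw; split=> //= uv.
    by case: (BC u) => //; rewrite uv.
  exists C, C, (A `&` B); split=> // u v w Cu Cv [Aw Bw]; split=> //= vw.
  by case: (BC w) => //; rewrite -vw.
have PA1 x y : P° (x, y, y) -> A x by move=> /interior_subset[/= + _]; apply.
have PA2 x y : P° (y, y, x) -> A x by move=> /interior_subset[/= _]; apply.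
move=> x y; split; split.
- by move=> /(AP x y)[].
- exact: PA1.
- by move=> /PA1 /(AP x y)[].
- by move=> /PA2 /(AP x y)[].
Qed.

(** The separating sets come from the sides of an open box around (x, y, y) inside [A']. *)
Lemma mirrored_open_extension_R1 (S : topologicalType) :
  mirrored_open_extension S -> R1_space S.
Proof.
move=> ext x y [A [oA Ax nAy]]; have [A' [oA' AA']] := ext A oA.
have [U [V [W [[oU Ux] [oV Vy] [oW Wy] sA']]]] :
    exists U V W, [/\ open_nbhs x U, open_nbhs y V, open_nbhs y W &
      forall u v w, U u -> V v -> W w -> A' (u, v, w)].
  apply/nbhs_prod3P/open_nbhs_nbhs; split=> //.
  exact: (AA' x y).1.1.
exists U, (V `&` W); split=> //; first exact: openI.
(* A common point [z] gives [(z, z, y)] in [A'], which by mirroring puts [y] in [A]. *)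
rewrite -subset0 => z [Uz [Vz Wz]]; apply: nAy.
by apply/(AA' y z).1/(AA' y z).2; exact: sA'.
Qed.

Section EpiRegularMonoFactorization.
Variables (S R' : topologicalType).
Variables (r' : hom Top (two_squares S) R') (k : hom Top R' (cube S)).
Hypotheses (epi_r' : epimorphism r') (phiE : phi S = k \oc r').

Let krE p : k (r' p) = phi_fun p.
Proof. by have /continuousEP/(_ p) := phiE. Qed.

(** The co-Mal'tsev property is applied to the restrictions of [r'] to the two copies of the square;
    they are jointly epic because [r'] is epic. *)
Lemma co_maltsev_factors_copi1 : co_maltsev_object Top S ->
  exists! f : hom Top R' S, f \oc r' = copi1 S.
Proof.
pose i b : hom Top (square S) (two_squares S) :=
  mkcts (@existT_continuous bool (fun=> square S) b).
have c1 : continuous (fst : square S -> S) by move=> q; exact: cvg_fst.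
have c2 : continuous (snd : square S -> S) by move=> q; exact: cvg_snd.
have c11 : continuous (fun q : cube S => q.1.1).
  by move=> [q z]; apply: (cvg_comp _ _ (@cvg_fst _ _ (nbhs q) (nbhs z) _)); exact: c1.
have c12 : continuous (fun q : cube S => q.1.2).
  by move=> [q z]; apply: (cvg_comp _ _ (@cvg_fst _ _ (nbhs q) (nbhs z) _)); exact: c2.
have c22 : continuous (fun q : cube S => q.2) by move=> q; exact: cvg_snd.
pose p1 : hom Top (square S) S := mkcts c1.
pose p2 : hom Top (square S) S := mkcts c2.
pose q1 : hom Top (cube S) S := mkcts c11.
pose q2 : hom Top (cube S) S := mkcts c12.
pose q3 : hom Top (cube S) S := mkcts c22.
have epi : @jointly_monic (op Top) R' (square S) (square S)
    (r' \oc i true) (r' \oc i false).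
  move=> T u v /continuousEP euvt /continuousEP euvf; apply: epi_r'.
  by apply/continuousEP => -[[] q]; [exact: euvt|exact: euvf].
pose R := @InternalRelation (op Top) (square S) (square S) R'
  (r' \oc i true) (r' \oc i false) epi.
(* The three coordinates of [k] witness the premises: on (x, y, y) and (y, y, x) they take the
   values x and y, then y and y, then y and x. The conclusion asks for x on both. *)
case/(_ _ _ R p1 p2 p1 p2).
- by exists (q1 \oc k); split; apply/continuousEP => -[x y] /=;
    rewrite /mkcts krE.
- by exists (q2 \oc k); split; apply/continuousEP => -[x y] /=;
    rewrite /mkcts krE.
- by exists (q3 \oc k); split; apply/continuousEP => -[x y] /=;
    rewrite /mkcts krE.
move=> f0 [/continuousEP ft /continuousEP ff]; pose f : hom Top R' S := f0.
have fr : f \oc r' = copi1 S.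
  by apply/continuousEP => -[[] q]; [exact: ft|exact: ff].
by exists f; split=> // g gr; apply: epi_r'; rewrite fr gr.
Qed.

Lemma factors_copi1_mirrored_open_extension (f : hom Top R' S) :
  regular_monomorphism k -> f \oc r' = copi1 S -> mirrored_open_extension S.
Proof.
move=> reg_k /continuousEP frE A oA.
have [A' oA' kA'] : exists2 A', open A' & k @^-1` A' = f @^-1` A.
  by apply: regular_mono_open => //; apply: open_comp => // p _; exact: cts_fun.
have AA' p : A (copi1 S p) <-> A' (phi_fun p).
  by rewrite -(frE p) -krE -[A' _]/((k @^-1` A') (r' p)) kA'.
exists A'; split=> // x y.
have t := AA' (existT _ true (x, y)); have s := AA' (existT _ false (x, y)).
by split; [exact: t|exact: iff_trans (iff_sym t) s].
Qed.

End EpiRegularMonoFactorization.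

Theorem theorem3p1 (S R' : topologicalType)
  (r' : hom Top (two_squares S) R') (k : hom Top R' (cube S))
  (hr' : epimorphism r') (hk : regular_monomorphism k)
  (hphi : phi S = k \oc r') :
  [<-> co_maltsev_object Top S;
       exists! f : hom Top R' S, f \oc r' = copi1 S;
       forall A : set S, open A ->
         exists A' : set (S * S * S)%type, open A' /\
           forall x y : S,
             (A x <-> A' (x, y, y)) /\ (A' (x, y, y) <-> A' (y, y, x));
       R1_space S ].
Proof.
tfae.
- exact: co_maltsev_factors_copi1 hphi.
- by case=> f [fr _]; exact: (factors_copi1_mirrored_open_extension hphi hk fr).
- exact: mirrored_open_extension_R1.
- by move/R1_mirrored_open_extension/mirrored_open_extension_co_maltsev.
Qed.
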